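(* Let $\alpha,\beta,\gamma\in\mathbb{R}$, and let $(G_3,g,J)$ be the connected, simply connected three-dimensional Lorentzian Lie group with product structure $J$ whose Lie algebra $\mathfrak{g}$ has a pseudo-orthonormal basis $\{e_1,e_2,e_3\}$ ($e_3$ timelike) with $[e_1,e_2]=-\gamma e_3$, $[e_1,e_3]=-\beta e_2$, $[e_2,e_3]=\alpha e_1$. Let $c\in\mathbb{R}$. Then $(G_3,g,J)$ is a first kind algebraic Ricci soliton associated to the Kobayashi-Nomizu connection $\nabla^1$ with constant $c$ if and only if one of the following holds: (i) $\alpha\beta\neq 0$, $\gamma=0$, $c=0$; in particular, $D=0$; (ii) $\alpha=\beta=\gamma=0$, $c\neq 0$; in particular, $De_i=-ce_i$ for $i=1,2,3$; (iii) $\alpha=0$, $\gamma\beta+c=0$; in particular, $De_1=0$, $De_2=-ce_2$, $De_3=-ce_3$; (iv) $\beta=0$, $\gamma\alpha+c=0$; in particular, $De_1=-ce_1$, $De_2=0$, $De_3=-ce_3$.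
   Context: The left-invariant Lorentzian metric $g$ satisfies $g(e_1,e_1)=g(e_2,e_2)=1$, $g(e_3,e_3)=-1$, $g(e_i,e_j)=0$ for $i\ne j$. All tensors and connections are left-invariant and evaluated on $\mathfrak{g}$. $\nabla$ is the Levi-Civita connection of $g$. The product structure is $Je_1=e_1$, $Je_2=e_2$, $Je_3=-e_3$, and $(\nabla_XJ)Y=\nabla_X(JY)-J(\nabla_XY)$. The canonical connection is $\nabla^0_XY=\nabla_XY-\frac12(\nabla_XJ)(JY)$ and the Kobayashi-Nomizu connection is $\nabla^1_XY=\nabla^0_XY-\frac14[(\nabla_YJ)(JX)-(\nabla_{JY}J)X]$, with curvature $R^1(X,Y)Z=\nabla^1_X\nabla^1_YZ-\nabla^1_Y\nabla^1_XZ-\nabla^1_{[X,Y]}Z$. Its Ricci tensor is $\rho^1(X,Y)=-g(R^1(X,e_1)Y,e_1)-g(R^1(X,e_2)Y,e_2)+g(R^1(X,e_3)Y,e_3)$ and the Ricci operator $\mathrm{Ric}^1$ is defined by $\rho^1(X,Y)=g(\mathrm{Ric}^1(X),Y)$. First kind algebraic Ricci soliton associated to $\nabla^1$ with constant $c$ means: $\mathrm{Ric}^1=c\,\mathrm{Id}+D$ where $D$ is a derivation of $\mathfrak{g}$, i.e. a linear map with $D[X,Y]=[DX,Y]+[X,DY]$ for all $X,Y\in\mathfrak{g}$. *)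

(* Defs.v *)
From HB Require Import structures.
From mathcomp Require Import all_boot all_order all_algebra.
From mathcomp Require Import reals.

Set Implicit Arguments.
Unset Strict Implicit.
Unset Printing Implicit Defensive.

Import Order.TTheory GRing.Theory Num.Theory.
Local Open Scope ring_scope.

(* Left-invariant tensors and connections on a Lie group are identified with
   (multi)linear maps on its Lie algebra V. *)

Definition lie_bracket (R : realType) (V : vectType R)
    (br : {bilinear V -> V -> V}) : Prop :=
  (forall X, br X X = 0) /\
  (forall X Y Z, br X (br Y Z) + br Y (br Z X) + br Z (br X Y) = 0).

Definition pseudo_orthonormal_basis (R : realType) (V : vectType R)
    (g : {symmetric V}) (e1 e2 e3 : V) : Prop :=
  [/\ basis_of fullv [:: e1; e2; e3],
      [/\ g e1 e1 = 1, g e2 e2 = 1 & g e3 e3 = -1]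
    & [/\ g e1 e2 = 0, g e1 e3 = 0 & g e2 e3 = 0]].

Definition product_structure (R : realType) (V : vectType R)
    (e1 e2 e3 : V) (J : 'End(V)) : Prop :=
  [/\ J e1 = e1, J e2 = e2 & J e3 = - e3].

(* The term X (g Y Z) of metric compatibility is absent because g Y Z is
   constant for left-invariant Y and Z. *)
Definition levi_civita (R : realType) (V : vectType R)
    (br : {bilinear V -> V -> V}) (g : {symmetric V})
    (nabla : {bilinear V -> V -> V}) : Prop :=
  (forall X Y, nabla X Y - nabla Y X = br X Y) /\
  (forall X Y Z, g (nabla X Y) Z + g Y (nabla X Z) = 0).

(* cov_deriv nabla J X Y is (nabla_X J) Y. *)
Definition cov_deriv (R : realType) (V : vectType R)
    (nabla : V -> V -> V) (J : 'End(V)) (X Y : V) : V :=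
  nabla X (J Y) - J (nabla X Y).

Definition canonical_connection (R : realType) (V : vectType R)
    (nabla : V -> V -> V) (J : 'End(V)) (X Y : V) : V :=
  nabla X Y - 2%:R^-1 *: cov_deriv nabla J X (J Y).

Definition kobayashi_nomizu (R : realType) (V : vectType R)
    (nabla : V -> V -> V) (J : 'End(V)) (X Y : V) : V :=
  canonical_connection nabla J X Y
  - 4%:R^-1 *: (cov_deriv nabla J Y (J X) - cov_deriv nabla J (J Y) X).

Definition curvature (R : realType) (V : vectType R)
    (br nabla : V -> V -> V) (X Y Z : V) : V :=
  nabla X (nabla Y Z) - nabla Y (nabla X Z) - nabla (br X Y) Z.

Definition ricci_tensor (R : realType) (V : vectType R)
    (br : V -> V -> V) (g : V -> V -> R) (e1 e2 e3 : V)
    (nabla : V -> V -> V) (X Y : V) : R :=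
  - g (curvature br nabla X e1 Y) e1
  - g (curvature br nabla X e2 Y) e2
  + g (curvature br nabla X e3 Y) e3.

Definition ricci_operator (R : realType) (V : vectType R)
    (g rho : V -> V -> R) (Ric : 'End(V)) : Prop :=
  forall X Y, rho X Y = g (Ric X) Y.

Definition derivation (R : realType) (V : vectType R)
    (br : V -> V -> V) (D : 'End(V)) : Prop :=
  forall X Y, D (br X Y) = br (D X) Y + br X (D Y).

Definition soliton_with (R : realType) (V : vectType R)
    (br : V -> V -> V) (Ric : 'End(V)) (c : R) (D : 'End(V)) : Prop :=
  Ric = c *: \1%VF + D /\ derivation br D.

Definition algebraic_ricci_soliton (R : realType) (V : vectType R)
    (br : V -> V -> V) (Ric : 'End(V)) (c : R) : Prop :=
  exists D : 'End(V), soliton_with br Ric c D.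

(* Main.v *)
(* On the eigenspaces of J the Kobayashi-Nomizu connection is easy to describe:
   if X and Y lie in the same eigenspace, nabla^1_X Y is the projection of
   nabla_X Y to that eigenspace; if they lie in opposite ones, it is the
   projection of [X, Y] to the eigenspace of Y. Here this leaves only
   nabla^1_{e3} e1 = beta e2 and nabla^1_{e3} e2 = - alpha e1, so that
   R^1(e1, e2) = gamma nabla^1_{e3}, R^1(ei, e3) = 0, and Ric^1 is diagonal with eigenvalues
   - gamma beta, - gamma alpha, 0. Hence D = Ric^1 - c Id is diagonal, and D is
   a derivation iff the structure constants satisfy
     gamma (gamma beta + gamma alpha + c) = 0,
     beta (gamma beta - gamma alpha + c) = 0,
     alpha (gamma alpha - gamma beta + c) = 0. *)

Require Import Defs.
From HB Require Import structures.
From mathcomp Require Import all_boot all_order all_algebra.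
From mathcomp Require Import reals.
From mathcomp Require Import ring lra.

Set Implicit Arguments.
Unset Strict Implicit.
Unset Printing Implicit Defensive.

Import Order.TTheory GRing.Theory Num.Theory.
Local Open Scope ring_scope.

(* Turns vector identities into scalar ones, within reach of [ring]. *)
Lemma coord_vbasis_inj (R : realType) (V : vectType R) (x y : V) :
  (forall i, coord (vbasis fullv) i x = coord (vbasis fullv) i y) -> x = y.
Proof.
move=> xy; rewrite (coord_vbasis (memvf x)) (coord_vbasis (memvf y)).
by apply: eq_bigr => i _; rewrite xy.
Qed.

(** * The Kobayashi-Nomizu connection on eigenvectors of [J] *)

Section KobayashiNomizu.
Variables (R : realType) (V : vectType R) (nabla : {bilinear V -> V -> V}).
Variable J : 'End(V).

(** The correction to the canonical connection cancels, since (nabla_Y J)(JX) and (nabla_{JY} J)X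
    both equal s (nabla_Y J)X. *)
Lemma kobayashi_nomizu_same (s : R) (X Y : V) :
  s * s = 1 -> J X = s *: X -> J Y = s *: Y ->
  kobayashi_nomizu nabla J X Y = 2^-1 *: (nabla X Y + s *: J (nabla X Y)).
Proof.
move=> ss JX JY; apply: coord_vbasis_inj => i.
rewrite /kobayashi_nomizu /canonical_connection /cov_deriv.
rewrite !(JX, JY, linearZ_LR, linearZl_LR, linearB, linearD) /= !(JX, JY).
rewrite !(linearZ_LR, linearZl_LR, linearB, linearD) /=.
by field: ss.
Qed.

(** Here the two correction terms add up to -2s (nabla_Y J)X = 2 (1 + sJ) nabla_Y X, which completes
    nabla_X Y to a commutator. *)
Lemma kobayashi_nomizu_opp (s : R) (X Y : V) :
  s * s = 1 -> J X = - s *: X -> J Y = s *: Y ->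
  kobayashi_nomizu nabla J X Y =
  2^-1 *: (nabla X Y - nabla Y X + s *: J (nabla X Y - nabla Y X)).
Proof.
move=> ss JX JY; apply: coord_vbasis_inj => i.
rewrite /kobayashi_nomizu /canonical_connection /cov_deriv.
rewrite !(JX, JY, linearZ_LR, linearZl_LR, linearB, linearD) /= !(JX, JY).
rewrite !(linearZ_LR, linearZl_LR, linearB, linearD) /=.
by field: ss.
Qed.

(** Homogeneity in each argument suffices for the curvature: on basis vectors both the bracket and
    the connection give multiples of basis vectors. *)
Lemma kobayashi_nomizuZl (a : R) (X Y : V) :
  kobayashi_nomizu nabla J (a *: X) Y = a *: kobayashi_nomizu nabla J X Y.
Proof.
apply: coord_vbasis_inj => i.
rewrite /kobayashi_nomizu /canonical_connection /cov_deriv.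
rewrite !(linearZ_LR, linearZl_LR, linearB, linearD) /=.
by ring.
Qed.

Lemma kobayashi_nomizuZr (a : R) (X Y : V) :
  kobayashi_nomizu nabla J X (a *: Y) = a *: kobayashi_nomizu nabla J X Y.
Proof.
apply: coord_vbasis_inj => i.
rewrite /kobayashi_nomizu /canonical_connection /cov_deriv.
rewrite !(linearZ_LR, linearZl_LR, linearB, linearD) /=.
by ring.
Qed.

End KobayashiNomizu.

(** * The Koszul formula and antisymmetry of the bracket *)

(** Torsion-freeness expresses the brackets through [nabla]; metric compatibility at the three
    cyclic rotations of X, Y, Z then gives a linear system. *)
Lemma levi_civita_koszul (R : realType) (V : vectType R)
    (br : {bilinear V -> V -> V}) (g : {symmetric V})
    (nabla : {bilinear V -> V -> V}) (X Y Z : V) :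
  levi_civita br g nabla ->
  g (nabla X Y) Z = 2^-1 * (g (br X Y) Z - g (br Y Z) X + g (br Z X) Y).
Proof.
move=> [tors metr].
have gC u v : g u v = g v u by rewrite hermC expr0 mul1r.
rewrite -!tors !linearBl /=.
have := metr X Y Z; have := metr Y Z X; have := metr Z X Y.
rewrite (gC X) (gC Y) (gC Z).
by move=> *; lra.
Qed.

Lemma alternating_antisym (R : realType) (V : vectType R)
    (br : {bilinear V -> V -> V}) (X Y : V) :
  (forall Z, br Z Z = 0) -> br X Y = - br Y X.
Proof.
move=> brxx; have := brxx (X + Y).
rewrite linearDl !linearDr /= !brxx add0r addr0.
by move/eqP; rewrite addr_eq0 => /eqP.
Qed.

(** * Coordinates and extension from a pseudo-orthonormal basis *)

Section PseudoOrthonormal.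
Variables (R : realType) (V : vectType R) (g : {symmetric V}) (e1 e2 e3 : V).
Hypothesis pob : pseudo_orthonormal_basis g e1 e2 e3.

(** The minus sign compensates for [g e3 e3 = -1]. *)
Lemma pseudo_orthonormalE (v : V) :
  v = g v e1 *: e1 + g v e2 *: e2 - g v e3 *: e3.
Proof.
have gC x y : g x y = g y x by rewrite hermC expr0 mul1r.
have [be [g11 g22 g33] [g12 g13 g23]] := pob.
have := memvf v; rewrite -(span_basis be) span_cons => /memv_addP[u].
move=> /vlineP[a ->] [w]; rewrite span_cons => /memv_addP[u'].
move=> /vlineP[b ->] [w']; rewrite span_seq1 => /vlineP[d ->] -> ->.
rewrite !linearDl !linearZl_LR /= g11 g22 g33 (gC e2 e1) (gC e3 e1) (gC e3 e2).
by rewrite g12 g13 g23 !(mulr0, mulr1, addr0, add0r) mulrN1 scaleNr opprK addrA.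
Qed.

Lemma pseudo_orthonormal_ind (P : V -> Prop) :
  (forall a x y, P x -> P y -> P (a *: x + y)) ->
  P 0 -> P e1 -> P e2 -> P e3 -> forall v, P v.
Proof.
move=> Plin P0 P1 P2 P3 v; rewrite (pseudo_orthonormalE v) -scaleNr -addrA.
by do 2!apply: (Plin) => //; rewrite -[_ *: e3]addr0; apply: Plin.
Qed.

Lemma eq_from_pseudo_orthonormal (W : vectType R) (f h : 'Hom(V, W)) :
  f e1 = h e1 -> f e2 = h e2 -> f e3 = h e3 -> f = h.
Proof.
move=> f1 f2 f3; apply/lfunP; apply: pseudo_orthonormal_ind => //.
  by move=> a x y fx fy; rewrite !linearP /= fx fy.
by rewrite !linear0.
Qed.

(** The defect D[X,Y] - [DX,Y] - [X,DY] is bilinear and alternating, so three pairs determine it. *)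
Lemma derivation_pseudo_orthonormal (br : {bilinear V -> V -> V})
    (D : 'End(V)) :
  (forall X, br X X = 0) ->
  D (br e1 e2) = br (D e1) e2 + br e1 (D e2) ->
  D (br e1 e3) = br (D e1) e3 + br e1 (D e3) ->
  D (br e2 e3) = br (D e2) e3 + br e2 (D e3) ->
  derivation br D.
Proof.
move=> brxx D12 D13 D23.
have brC x y : br x y = - br y x by exact: alternating_antisym.
pose P X Y := D (br X Y) = br (D X) Y + br X (D Y).
have PC X Y : P X Y -> P Y X.
  by rewrite /P (brC Y X) linearN (brC (D Y) X) (brC Y (D X)) /= => ->;
    rewrite opprD addrC.
have Pdiag X : P X X by rewrite /P brxx linear0 (brC (D X)) addNr.
have Plin Z a X Y : P Z X -> P Z Y -> P Z (a *: X + Y).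
  rewrite /P !linearP /= => -> ->.
  by rewrite scalerDr addrACA.
have P0 Z : P Z 0 by rewrite /P !linear0 addr0.
have Pbasis Z : P Z e1 -> P Z e2 -> P Z e3 -> forall Y, P Z Y.
  by move=> Z1 Z2 Z3; apply: (@pseudo_orthonormal_ind (P Z)) => //;
    exact: Plin.
(* Reduce Y to the basis, swap the arguments, then reduce X. *)
by move=> X Y; apply: (Pbasis); apply: (PC); apply: (Pbasis) => //; apply: PC.
Qed.

End PseudoOrthonormal.

(** * Connection, curvature and Ricci operator of the group *)

Section LieGroupG3.
Variables (R : realType) (alpha beta gamma : R) (V : vectType R).
Variables (br : {bilinear V -> V -> V}) (g : {symmetric V}) (e1 e2 e3 : V).
Variables (J : 'End(V)) (nabla : {bilinear V -> V -> V}).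
Hypothesis brxx : forall X, br X X = 0.
Hypothesis pob : pseudo_orthonormal_basis g e1 e2 e3.
Hypothesis br12 : br e1 e2 = - gamma *: e3.
Hypothesis br13 : br e1 e3 = - beta *: e2.
Hypothesis br23 : br e2 e3 = alpha *: e1.
Hypothesis hJ : product_structure e1 e2 e3 J.
Hypothesis LC : levi_civita br g nabla.

Local Notation kn := (kobayashi_nomizu nabla J).

Let gC x y : g x y = g y x. Proof. by rewrite hermC expr0 mul1r. Qed.

Let brE : (br e2 e1 = gamma *: e3) * (br e3 e1 = beta *: e2) *
  (br e3 e2 = - alpha *: e1).
Proof.
rewrite !(alternating_antisym _ e1 brxx) (alternating_antisym e3 e2 brxx).
by rewrite br12 br13 br23 !scaleNr !opprK.
Qed.

Let gE : ((g e1 e1 = 1) * (g e2 e2 = 1) * (g e3 e3 = -1) * (g e1 e2 = 0) *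
  (g e1 e3 = 0) * (g e2 e3 = 0) * (g e2 e1 = 0) * (g e3 e1 = 0) *
  (g e3 e2 = 0))%type.
Proof.
have [_ [g11 g22 g33] [g12 g13 g23]] := pob.
by rewrite (gC e2 e1) (gC e3 e1) (gC e3 e2) !(g11, g22, g33, g12, g13, g23).
Qed.

(** Only pairs within one eigenspace of [J] are listed: mixed pairs enter [kn] through their bracket
    alone. *)
Let nablaE : (nabla e1 e1 = 0) * (nabla e2 e2 = 0) * (nabla e3 e3 = 0) *
  (nabla e1 e2 = (2^-1 * (alpha - beta - gamma)) *: e3) *
  (nabla e2 e1 = (2^-1 * (alpha - beta + gamma)) *: e3).
Proof.
have gnE := levi_civita_koszul _ _ _ LC.
do !split; rewrite [LHS](pseudo_orthonormalE pob) !gnE !brxx;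
  rewrite ?(br12, br13, br23, brE) ?linear0l ?linearZl_LR /= !gE;
  rewrite !(mulr0, addr0, add0r, subr0, oppr0, scale0r) //.
- by rewrite -scaleNr; congr (_ *: _); ring.
- by rewrite -scaleNr; congr (_ *: _); ring.
Qed.

(** On e1, e2 the values of [nabla] are multiples of e3, which the projection to the +1 eigenspace
    kills. The brackets of e1, e2 with e3 lie in that eigenspace, so they survive only when e3 is
    the first argument. *)
Lemma kobayashi_nomizuE :
  (kn e1 e1 = 0) * (kn e1 e2 = 0) * (kn e1 e3 = 0) *
  (kn e2 e1 = 0) * (kn e2 e2 = 0) * (kn e2 e3 = 0) *
  (kn e3 e1 = beta *: e2) * (kn e3 e2 = - alpha *: e1) * (kn e3 e3 = 0).
Proof.
have [J1 J2 J3] := hJ; have [tors _] := LC.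
(* The letters p and m record the signs of the eigenvalues of the two arguments. *)
have pp X Y : J X = X -> J Y = Y ->
    kn X Y = 2^-1 *: (nabla X Y + J (nabla X Y)).
  move=> JX JY; rewrite (@kobayashi_nomizu_same _ _ _ _ 1) ?scale1r //.
  exact: mul1r.
have pm X : J X = X -> kn X e3 = 2^-1 *: (br X e3 - J (br X e3)).
  move=> JX; rewrite (@kobayashi_nomizu_opp _ _ _ _ (-1)) ?opprK ?scale1r //.
  - by rewrite tors scaleN1r.
  - by rewrite mulrNN mul1r.
  - by rewrite scaleN1r.
have mp Y : J Y = Y -> kn e3 Y = 2^-1 *: (br e3 Y + J (br e3 Y)).
  move=> JY; rewrite (@kobayashi_nomizu_opp _ _ _ _ 1) ?scale1r ?scaleN1r //.
  - by rewrite tors.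
  - exact: mul1r.
have mm : kn e3 e3 = 0.
  rewrite (@kobayashi_nomizu_same _ _ _ _ (-1)) ?scaleN1r //.
  - by rewrite nablaE linear0 subr0 scaler0.
  - by rewrite mulrNN mul1r.
have half (x : V) : 2^-1 *: (x + x) = x.
  by rewrite -mulr2n -scaler_nat scalerA mulVf ?scale1r ?pnatr_eq0.
rewrite mm !mp // !pm // !pp // !(br13, br23, brE, nablaE) !linearZ /= J1 J2 J3.
by rewrite !half !linear0 !scalerN !subrr !addr0 !scaler0.
Qed.

Let kn0l X : kn 0 X = 0.
Proof. by rewrite -[0 in LHS](scale0r e1) kobayashi_nomizuZl scale0r. Qed.

Let kn0r X : kn X 0 = 0.
Proof. by rewrite -[0 in LHS](scale0r e1) kobayashi_nomizuZr scale0r. Qed.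

Let brknE := (brxx, (br12, br13, br23), brE,
  (@kobayashi_nomizuZl _ _ nabla J, @kobayashi_nomizuZr _ _ nabla J),
  kobayashi_nomizuE, (kn0l, kn0r, scaler0, scalerA),
  (subr0, sub0r, oppr0, subrr)).

(** The operators [kn e1] and [kn e2] vanish on the basis, so R(e1,e3) and R(e2,e3) vanish too,
    their brackets being multiples of e2 and e1; for R(e1,e2) only the bracket term remains. *)
Lemma curvatureE :
  [/\ forall Z, Z \in [:: e1; e2; e3] -> curvature br kn e1 e3 Z = 0,
    forall Z, Z \in [:: e1; e2; e3] -> curvature br kn e2 e3 Z = 0,
    curvature br kn e1 e2 e1 = (gamma * beta) *: e2,
    curvature br kn e1 e2 e2 = - (gamma * alpha) *: e1
  & curvature br kn e1 e2 e3 = 0].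
Proof.
rewrite /curvature; split=> [Z|Z|||].
1,2: by rewrite !inE => /or3P[] /eqP->; rewrite !brknE.
1,2: by rewrite !brknE -scaleNr mulNr ?mulrN !opprK.
by rewrite !brknE.
Qed.

Let curvC X Y Z : curvature br kn Y X Z = - curvature br kn X Y Z.
Proof.
rewrite /curvature (alternating_antisym Y X brxx) -(scaleN1r (br X Y)).
rewrite kobayashi_nomizuZl scaleN1r opprK !opprB.
by rewrite addrC.
Qed.

Variable Ric : 'End(V).
Hypothesis hRic : ricci_operator g (ricci_tensor br g e1 e2 e3 kn) Ric.

(** Up to sign, the coordinates of [Ric] on a basis vector are values of the Ricci tensor, to which
    only R(e1,e2) contributes. *)
Lemma ricci_operatorE :
  [/\ Ric e1 = - (gamma * beta) *: e1, Ric e2 = - (gamma * alpha) *: e2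
    & Ric e3 = 0].
Proof.
have [R13 R23 R121 R122 R123] := curvatureE.
have R0 X Z : curvature br kn X X Z = 0.
  by rewrite /curvature brxx kn0l !subrr.
have e_in : (e1 \in [:: e1; e2; e3]) * (e2 \in [:: e1; e2; e3]) *
    (e3 \in [:: e1; e2; e3]) by rewrite !inE !eqxx !orbT.
split; rewrite [LHS](pseudo_orthonormalE pob) -!hRic /ricci_tensor.
all: rewrite ?(curvC e1 e2) ?(curvC e1 e3) ?(curvC e2 e3).
all: rewrite !(R0, R13, R23, R121, R122, R123) ?e_in //.
all: rewrite !(linearNl, linearZl_LR, linear0l) /= ?gE.
all: rewrite !(oppr0, mulr0, mulr1, sub0r, subr0, addr0, opprK, scale0r).
all: by rewrite ?add0r.
Qed.

(** * The soliton condition as a polynomial system *)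

Lemma soliton_mapE (c : R) (D : 'End(V)) :
  Ric = c *: \1%VF + D ->
  [/\ D e1 = (- (gamma * beta) - c) *: e1,
    D e2 = (- (gamma * alpha) - c) *: e2 & D e3 = - c *: e3].
Proof.
have [R1 R2 R3] := ricci_operatorE.
move/eqP; rewrite addrC -subr_eq => /eqP <-.
by rewrite !(add_lfunE, opp_lfunE, scale_lfunE, id_lfunE) R1 R2 R3 sub0r
  !scalerBl !scaleNr.
Qed.

(** When [ei,ej] is a multiple of ek, the Leibniz rule at that pair says dk = di + dj, weighted by
    the structure constant. *)
Lemma diagonal_derivationP (d1 d2 d3 : R) (D : 'End(V)) :
  D e1 = d1 *: e1 -> D e2 = d2 *: e2 -> D e3 = d3 *: e3 ->
  derivation br D <->
  [/\ gamma * (d3 - d1 - d2) = 0, beta * (d2 - d1 - d3) = 0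
    & alpha * (d1 - d2 - d3) = 0].
Proof.
move=> D1 D2 D3; split=> [der | [h12 h13 h23]].
  have := der e2 e3; have := der e1 e3; have := der e1 e2.
  rewrite !(D1, D2, D3, br12, br13, br23, linearZ, linearZl_LR, linearZr_LR) /=.
  rewrite !(D1, D2, D3, br12, br13, br23).
  (* Pairing each identity with the basis vector it is a multiple of extracts the scalar
     equation. *)
  move=> /(congr1 (g^~ e3)) h12 /(congr1 (g^~ e2)) h13 /(congr1 (g^~ e1)) h23.
  move: h12 h13 h23.
  rewrite !(linearDl, linearZl_LR) /= !gE => h12 h13 h23.
  by split; lra.
apply: (derivation_pseudo_orthonormal pob brxx).
all: rewrite !(D1, D2, D3, br12, br13, br23) !(linearZ, linearZl_LR) /=.
all: rewrite !(D1, D2, D3, br12, br13, br23) !scalerA -scalerDl.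
all: by congr (_ *: _); lra.
Qed.

Lemma algebraic_ricci_solitonE (c : R) :
  algebraic_ricci_soliton br Ric c <->
  [/\ gamma * (gamma * beta + gamma * alpha + c) = 0,
    beta * (gamma * beta - gamma * alpha + c) = 0
  & alpha * (gamma * alpha - gamma * beta + c) = 0].
Proof.
have DE D : Ric = c *: \1%VF + D -> derivation br D <->
  [/\ gamma * (- c - (- (gamma * beta) - c) - (- (gamma * alpha) - c)) = 0,
    beta * (- (gamma * alpha) - c - (- (gamma * beta) - c) - - c) = 0
  & alpha * (- (gamma * beta) - c - (- (gamma * alpha) - c) - - c) = 0].
  move=> /soliton_mapE[D1 D2 D3]; exact: diagonal_derivationP.
split=> [[D [/DE DP /DP[h1 h2 h3]]] | [h1 h2 h3]]; first by split; lra.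
exists (Ric - c *: \1%VF).
have RicE : Ric = c *: \1%VF + (Ric - c *: \1%VF).
  by rewrite addrC subrK.
by split=> //; apply/DE => //; split; lra.
Qed.

End LieGroupG3.

(** * Solving the polynomial system *)

Lemma soliton_systemP (R : realType) (alpha beta gamma c : R) :
  [/\ gamma * (gamma * beta + gamma * alpha + c) = 0,
    beta * (gamma * beta - gamma * alpha + c) = 0
  & alpha * (gamma * alpha - gamma * beta + c) = 0] <->
  [\/ [/\ alpha * beta != 0, gamma = 0 & c = 0],
      [/\ alpha = 0, beta = 0, gamma = 0 & c != 0],
      alpha = 0 /\ gamma * beta + c = 0
    | beta = 0 /\ gamma * alpha + c = 0].
Proof.
have cancel (x y : R) : x != 0 -> x * y = 0 -> y = 0.
  by move=> x0 /eqP; rewrite mulf_eq0 (negPf x0) => /eqP.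
split=> [[h1 h2 h3] | [[_ -> ->]|[-> -> -> _]|[-> h]|[-> h]]]; last first.
- have -> : c = - (gamma * alpha) by lra.
  by split; ring.
- have -> : c = - (gamma * beta) by lra.
  by split; ring.
- by split; ring.
- by split; ring.
have [a0|a0] := eqVneq alpha 0.
  (* Now [gamma] and [beta] both annihilate [gamma * beta + c]; if both are zero, [c] is free, and
     [c = 0] falls under the third case. *)
  subst alpha; rewrite mulr0 !addr0 in h1; rewrite mulr0 subr0 in h2.
  have [g0|g0] := eqVneq gamma 0;
    last by apply: Or43; split=> //; apply: cancel h1.
  have [b0|b0] := eqVneq beta 0;
    last by apply: Or43; split=> //; apply: cancel h2.
  subst gamma beta; have [->|c0] := eqVneq c 0; last exact: Or42.
  by apply: Or43; rewrite mul0r addr0.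
have [b0|b0] := eqVneq beta 0.
  subst beta; rewrite mulr0 subr0 in h3.
  by apply: Or44; split=> //; apply: cancel h3.
(* The sum of the two cancelled equations is 2c = 0, and their difference gives gamma alpha = gamma
   beta. A nonzero [gamma] would then force 2 gamma alpha = 0 through [h1]. *)
have {}h2 := cancel _ _ b0 h2; have {}h3 := cancel _ _ a0 h3.
have c0 : c = 0 by lra.
apply: Or41; split=> //; first exact: mulf_neq0.
apply/eqP/negPn/negP => g0; have {}h1 := cancel _ _ g0 h1.
have ga : gamma * alpha = 0 by lra.
by have /eqP := cancel _ _ g0 ga; rewrite (negPf a0).
Qed.

Theorem theorem2p29 (R : realType) (alpha beta gamma c : R)
    (V : vectType R) (br : {bilinear V -> V -> V}) (g : {symmetric V})
    (e1 e2 e3 : V) (J : 'End(V)) (nabla : {bilinear V -> V -> V})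
    (Ric1 : 'End(V)) :
  lie_bracket br ->
  pseudo_orthonormal_basis g e1 e2 e3 ->
  br e1 e2 = - gamma *: e3 ->
  br e1 e3 = - beta *: e2 ->
  br e2 e3 = alpha *: e1 ->
  product_structure e1 e2 e3 J ->
  levi_civita br g nabla ->
  ricci_operator g (ricci_tensor br g e1 e2 e3 (kobayashi_nomizu nabla J))
    Ric1 ->
  (algebraic_ricci_soliton br Ric1 c <->
    [\/ [/\ alpha * beta != 0, gamma = 0 & c = 0],
        [/\ alpha = 0, beta = 0, gamma = 0 & c != 0],
        alpha = 0 /\ gamma * beta + c = 0
      | beta = 0 /\ gamma * alpha + c = 0]) /\
  (forall D : 'End(V), soliton_with br Ric1 c D ->
    [/\ [/\ alpha * beta != 0, gamma = 0 & c = 0] -> D = 0,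
        [/\ alpha = 0, beta = 0, gamma = 0 & c != 0] ->
          [/\ D e1 = - c *: e1, D e2 = - c *: e2 & D e3 = - c *: e3],
        alpha = 0 /\ gamma * beta + c = 0 ->
          [/\ D e1 = 0, D e2 = - c *: e2 & D e3 = - c *: e3]
      & beta = 0 /\ gamma * alpha + c = 0 ->
          [/\ D e1 = - c *: e1, D e2 = 0 & D e3 = - c *: e3]]).
Proof.
move=> [brxx _] pob br12 br13 br23 hJ LC hRic.
split=> [|D [/(soliton_mapE brxx pob br12 br13 br23 hJ LC hRic)[D1 D2 D3] _]].
  apply: iff_trans (soliton_systemP _ _ _ _).
  exact: (algebraic_ricci_solitonE brxx pob br12 br13 br23 hJ LC hRic).
split=> [[_ g0 c0]|[a0 b0 g0 _]|[a0 h]|[b0 h]].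
- apply: (eq_from_pseudo_orthonormal pob);
    rewrite zero_lfunE ?(D1, D2, D3) ?g0 c0;
    by rewrite ?mul0r ?subr0 oppr0 scale0r.
- by rewrite D1 D2 D3 g0 !mul0r !oppr0 !sub0r.
(* The eigenvalue of [D] at e1 is minus the quantity that [h] sets to zero; in the last case this
   happens at e2. *)
- by rewrite D1 D2 D3 a0 mulr0 oppr0 sub0r -opprD h oppr0 scale0r.
- by rewrite D1 D2 D3 b0 mulr0 oppr0 sub0r -opprD h oppr0 scale0r.
Qed.
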